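(* For every integer $k\ge 2$, as $n\to\infty$, $$ex(n,C_4,C_{2k})=(1+o(1))\frac{(k-1)(k-2)}{4}n^2.$$
   Context: $C_k$ denotes the cycle with $k$ vertices. $ex(n,H,F)$ is the maximum number of subgraphs isomorphic to $H$ in an $n$-vertex graph containing no subgraph isomorphic to $F$. *)

(* Defs.v *)
From HB Require Import structures.
From mathcomp Require Import all_boot all_order all_algebra.
Set Implicit Arguments. Unset Strict Implicit. Unset Printing Implicit Defensive.
Import Order.TTheory GRing.Theory Num.Theory.

Definition simple_graph (n : nat) (E : {set {set 'I_n}}) : bool :=
  [forall e in E, #|e| == 2].

Definition cycle_edges (m n : nat) (f : 'I_m -> 'I_n) : {set {set 'I_n}} :=
  [set [set f i; f (ordS i)] | i : 'I_m].

Definition is_cycle_copy (m n : nat) (S : {set {set 'I_n}}) : bool :=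
  [exists f : {ffun 'I_m -> 'I_n}, injectiveb f && (S == cycle_edges f)].

Definition num_cycles (m n : nat) (E : {set {set 'I_n}}) : nat :=
  #|[set S : {set {set 'I_n}} | (S \subset E) &&
        is_cycle_copy m S ]|.

Definition contains_cycle (m n : nat) (E : {set {set 'I_n}}) : bool :=
  [exists S : {set {set 'I_n}}, (S \subset E) && is_cycle_copy m S ].

Definition ex_cycles (n h f : nat) : nat :=
  \max_(E : {set {set 'I_n}} | simple_graph E && ~~ contains_cycle f E)
     num_cycles h E.

(* Main.v *)
Require Import Defs.
From mathcomp Require Import all_boot all_order all_algebra.
From mathcomp Require Import zify ring lra.

(** Lower bound: in K_{k-1,n-k+1} a C_{2k} would need k vertices in the small
    class, while each pair from one class and pair from the other span a C_4.

    Upper bound: let G be C_{2k}-free, and let D = o(n^2) be its degree sum (G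
    contains no K_{k,k}).  A C_4 is a pair of diagonals, each contained in the
    common neighbourhood of the other.
    - The C_4 with a diagonal of codegree < k number at most
      C(n,2) C(k-1,2) ~ (k-1)(k-2) n^2 / 4.
    - Suppose a_1, .., a_k are neighbours of w and consecutive a_i have at least
      k common neighbours outside {a_1, .., a_k}.  Then greedily chosen
      connectors and w close a C_{2k}.  Hence, for a suitable notion of fat
      pair, the fat pairs inside N(w) form a graph without k-vertex paths, so
      there are O(deg w) of them, and summing over w bounds the sum of the
      codegrees of fat pairs by O(D).
    - Counting codegrees outside A, this applies to the pairs in A, for every
      vertex set A; averaging over A, only O(D) pairs have codegree >= k.  So
      only O(D) of the C_4 have a diagonal with codegree in [k, 2k].
    - With codegree >= 2k the vertices a_i are avoided for free.  For such a
      diagonal xy, the diagonals zt of codegree >= 2k inside the common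
      neighbourhood U of x, y number O(|U|) by the same path argument, so again
      only O(D) of the C_4 have two such diagonals. *)

Set Implicit Arguments. Unset Strict Implicit. Unset Printing Implicit Defensive.

(** * Graphs without long paths, and random separation *)

Lemma path_few_pairs (T : finType) (r : rel T) (m : nat) (U : {set T}) :
  symmetric r ->
  (forall x p, uniq (x :: p) -> {subset x :: p <= U} -> path r x p ->
     size p <> m) ->
  \sum_(x in U) #|[set y in U | r x y]| <= 2 * m * #|U|.
Proof.
move=> rC; move: {2}#|U| (leqnn #|U|) => c; elim: c U => [|c IHc] U leUc noP.
  move: leUc; rewrite leqn0 cards_eq0 => /eqP ->.
  by rewrite big_set0.
(* A vertex with at most [m] neighbours in [U] is deleted, which lowers the degree sum by at most
   [2 * m]. If there is none, a path can be extended greedily at its head until it has [m] edges. *)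
case: (boolP [exists v in U, #|[set y in U | r v y]| <= m]); last first.
  rewrite negb_exists_in => /forall_inP degU.
  have [->|[v vU]] := set_0Vmem U; first by rewrite big_set0.
  suff [x [p [up sp pp /eqP zp]]] : exists x p, [/\ uniq (x :: p),
      {subset x :: p <= U}, path r x p & size p == m].
    by case: (noP x p).
  have: m <= m by [].
  elim: {-2}m => [|j IHj] lejm.
    by exists v, [::]; split=> // z; rewrite inE => /eqP ->.
  have [x [p [up sp pp zp]]] := IHj (ltnW lejm).
  have xU : x \in U by apply: sp; rewrite inE eqxx.
  have: ~~ ([set y in U | r x y] \subset [set y in x :: p]).
    apply/negP => /subset_leq_card; move: (degU x xU); rewrite -ltnNge => h1 h2.
    have := leq_trans h1 h2; rewrite cardsE => h3.
    have := leq_trans h3 (card_size (x :: p)); rewrite /= (eqP zp); lia.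
  case/subsetPn => y; rewrite inE => /andP[yU rxy]; rewrite inE => yp.
  exists y, (x :: p); split.
  - by rewrite /= yp; exact: up.
  - by move=> z; rewrite inE => /orP[/eqP ->|/sp].
  - by rewrite /= rC rxy.
  - by rewrite /= eqSS.
case/exists_inP => v vU degv.
have cU : #|U| = #|U :\ v|.+1 by rewrite (cardsD1 v) vU.
have IH : \sum_(x in U :\ v) #|[set y in U :\ v | r x y]| <= 2 * m * #|U :\ v|.
  apply: IHc; first by move: leUc; rewrite cU.
  by move=> x p up sp; apply: noP => // z /sp; rewrite inE => /andP[].
rewrite (big_setD1 v vU) /= cU.
have split_deg x : x \in U :\ v ->
    #|[set y in U | r x y]| = #|[set y in U :\ v | r x y]| + r v x.
  move=> _; rewrite (cardsD1 v) inE vU /= rC addnC; congr (_ + _).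
  by apply: eq_card => y; rewrite !inE andbA.
rewrite (eq_bigr _ split_deg) big_split /=.
have : \sum_(x in U :\ v) r v x <= m.
  apply: leq_trans degv; rewrite -sum1_card big_mkcond [X in _ <= X]big_mkcond /=.
  apply: leq_sum => x _; rewrite !inE.
  by case: (r v x); case: (x \in U); rewrite ?andbF ?andbT //=; case: ifP.
lia.
Qed.

(** Forcing [X] in and [Y] out of a set [A] loses only the trace of [A] on [X :|: Y]; recording that
    trace makes the map injective. *)
Lemma leq_card_separating (T : finType) (X Y : {set T}) :
  [disjoint X & Y] ->
  2 ^ #|T| <= #|[set A : {set T} | (X \subset A) && [disjoint Y & A]]|
              * 2 ^ (#|X| + #|Y|).
Proof.
move=> dXY.
have cXY : #|X :|: Y| = #|X| + #|Y|.
  by rewrite cardsU (_ : X :&: Y = set0) ?cards0 ?subn0 //; apply/eqP; rewrite setI_eq0.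
rewrite -cXY -card_powerset -cardsX.
have -> : 2 ^ #|T| = #|{set T}|.
  by rewrite -[RHS]cardsT -powersetT card_powerset cardsT.
pose h (A : {set T}) := ((A :\: Y) :|: X, A :&: (X :|: Y)).
have h_inj : injective h.
  move=> A B [/setP e1 /setP e2]; apply/setP => z.
  move: (e1 z) (e2 z); rewrite !inE.
  by case: (z \in A); case: (z \in B); case: (z \in X); case: (z \in Y).
rewrite -(card_codom h_inj); apply: subset_leq_card; apply/subsetP => _ /codomP [A ->].
rewrite !inE subsetUr subsetIr andbT /=.
rewrite -setI_eq0; apply/eqP/setP => z; rewrite !inE.
move: dXY; rewrite -setI_eq0 => /eqP/setP/(_ z); rewrite !inE.
by case: (z \in X); case: (z \in Y).
Qed.

(** * Codegrees and edges in graphs without C_{2k} *)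

Section Graph.
Variables (n : nat) (E : {set {set 'I_n}}).
Hypothesis gE : simple_graph E.

Definition adj (x y : 'I_n) := [set x; y] \in E.
Definition nbr (x : 'I_n) := [set y | adj x y].
Definition conbr (x y : 'I_n) := nbr x :&: nbr y.
Definition degsum := \sum_x #|nbr x|.

Lemma adjC : symmetric adj.
Proof. by move=> x y; rewrite /adj setUC. Qed.

Lemma adj_irr x : adj x x = false.
Proof.
apply/negP => Exx; have := forall_inP gE _ Exx.
by rewrite setUid cards1.
Qed.

Lemma conbrC x y : conbr x y = conbr y x.
Proof. exact: setIC. Qed.

Lemma contains_cycle_seq (s : seq 'I_n) :
  uniq s -> cycle adj s -> 0 < size s -> contains_cycle (size s) E.
Proof.
case: s => // x p us cs _.
set m := size (x :: p).
pose f : {ffun 'I_m -> 'I_n} := [ffun i : 'I_m => nth x (x :: p) i].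
apply/existsP; exists (cycle_edges f); apply/andP; split; last first.
  apply/existsP; exists f; rewrite eqxx andbT; apply/injectiveP => i j.
  by rewrite !ffunE => /eqP; rewrite nth_uniq // => /eqP /val_inj.
apply/subsetP => _ /imsetP [i _ ->]; rewrite !ffunE.
move: cs => /= /(pathP x); rewrite size_rcons => /(_ i (ltn_ord i)).
rewrite /adj -rcons_cons !nth_rcons /= ltn_ord.
have := ltn_ord i; rewrite /m /= ltnS leq_eqVlt => /orP[/eqP -> |lip].
  by rewrite ltnn eqxx modnn.
by rewrite lip modn_small.
Qed.

Section CycleFree.
Variable k : nat.
Hypothesis k_gt1 : 1 < k.
Hypothesis E_free : ~~ contains_cycle (2 * k) E.

(* [q] interleaves [p] with the connectors [bs]. *)
Lemma greedy_connectors (B X : {set 'I_n}) x p :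
  path (fun y z => k <= #|conbr y z :&: B|) x p -> #|X| + size p <= k ->
  exists q bs, [/\ path adj x q, last x q = last x p, perm_eq q (p ++ bs),
    size bs = size p & uniq bs /\ {subset bs <= B :\: X}].
Proof.
elim: p x X => [|y p IHp] x X /=; first by exists [::], [::].
case/andP => fxy pp szX.
(* [X] collects the forbidden vertices and gains one per connector, so it has fewer than [k]
   elements at each choice. *)
have: ~~ (conbr x y :&: B \subset X).
  apply/negP => /subset_leq_card /(leq_trans fxy) kX.
  by have := leq_trans szX kX; rewrite addnS ltnNge leq_addr.
case/subsetPn => b; rewrite !inE -andbA => /and3P[xb yb bB] bX.
have [||q [bs [pq lq eq sz [ub sb]]]] := IHp y (b |: X) => //.
  by rewrite cardsU1 bX /=; move: szX; lia.
exists [:: b, y & q], (b :: bs); split.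
- by rewrite /= xb pq adjC yb.
- by [].
- by rewrite perm_sym (perm_catCA (y :: p) [:: b] bs) /= perm_sym !perm_cons.
- by rewrite /= sz.
- split=> [|z]; rewrite /= ?ub ?andbT.
    by apply/negP => /sb; rewrite !inE eqxx.
  rewrite inE => /orP[/eqP ->|/sb]; first by rewrite inE bX.
  by rewrite !inE negb_or -andbA => /and3P[_ -> ->].
Qed.

(** The [k] vertices of such a path, [k - 1] connectors and [w] would form a C_{2k}: [w] is adjacent
    to both ends of the path, and the connectors, taken in [B] and different from [w], miss the
    path. *)
Lemma no_fat_path (B : {set 'I_n}) w x p :
  uniq (x :: p) -> {subset x :: p <= nbr w} ->
  {in x :: p, forall z, z \notin B} ->
  path (fun y z => k <= #|conbr y z :&: B|) x p -> size p <> k.-1.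
Proof.
move=> up sp nB fp zp; case/negP: E_free.
have [|q [bs [pq lq eq sz [ub sb]]]] := @greedy_connectors B [set w] x p fp.
  by rewrite cards1 zp; lia.
have szq : size [:: w, x & q] = 2 * k.
  by rewrite /= (perm_size eq) size_cat sz zp; lia.
have wn : w \notin x :: p.
  by apply/negP => /sp; rewrite inE adj_irr.
rewrite -szq; apply: contains_cycle_seq => //.
- have perm : perm_eq [:: w, x & q] ((w :: x :: p) ++ bs).
    by rewrite /= !perm_cons.
  rewrite (perm_uniq perm) cat_uniq ub andbT [uniq _]/= -/(uniq (x :: p)) wn up /=.
  apply/hasPn => b /sb; rewrite !inE => /andP [bw bB]; rewrite (negbTE bw) /=.
  apply/negP => bp; have := nB b; rewrite !inE bp bB => h; by have := h isT.
- rewrite /= rcons_path pq lq /=.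
  have := sp x; rewrite !inE eqxx => ->//=.
  by rewrite adjC; have := sp (last x p); rewrite mem_last inE => ->.
Qed.

(** The left side counts triples [(w, x, y)] in which [w] is a common neighbour of [x] and [y]. For
    fixed [w], [path_few_pairs] applies inside [nbr w :&: A]. *)
Lemma sum_conbr_few_pairs (A : {set 'I_n}) (r : rel 'I_n) :
  symmetric r ->
  (forall w x p, uniq (x :: p) -> {subset x :: p <= nbr w :&: A} ->
     path r x p -> size p <> k.-1) ->
  \sum_(x in A) \sum_(y in A | r x y) #|conbr x y| <= 2 * k * degsum.
Proof.
move=> rC noP.
have -> : \sum_(x in A) \sum_(y in A | r x y) #|conbr x y|
    = \sum_w \sum_(x in nbr w :&: A) #|[set y in nbr w :&: A | r x y]|.
  under [RHS]eq_bigr => w _ do rewrite big_mkcond /=.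
  rewrite exchange_big /= big_mkcond; apply: eq_bigr => x _.
  case: ifP => xA; last by rewrite big1 // => w _; rewrite inE xA andbF.
  transitivity (\sum_w \sum_y ((y \in A) && r x y && (w \in conbr x y) : nat)).
    rewrite exchange_big big_mkcond; apply: eq_bigr => y _ /=.
    case: ifP => _; last by rewrite big1.
    by rewrite -sum1_card big_mkcond; apply: eq_bigr => w _; case: ifP.
  apply: eq_bigr => w _; rewrite inE xA andbT inE.
  case: ifP => wx; last first.
    by rewrite big1 // => y _; rewrite !inE (adjC x) wx andbF.
  rewrite -sum1_card [RHS]big_mkcond; apply: eq_bigr => y _.
  rewrite !inE (adjC x) (adjC y) wx.
  by case: (y \in A); case: (r x y); case: (adj w y).
rewrite /degsum big_distrr /=; apply: leq_sum => w _.
apply: leq_trans (path_few_pairs rC (@noP w)) _.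
by apply: leq_mul; [lia | rewrite subset_leq_card ?subsetIl].
Qed.

(** A counted pair has positive codegree, so it weighs at least 1 in [sum_conbr_few_pairs].
    Connectors outside [A] cannot meet a path inside [A]. *)
Lemma few_pairs_fat_outside (A : {set 'I_n}) :
  \sum_(x in A) #|[set y in A | k <= #|conbr x y :&: ~: A|]| <= 2 * k * degsum.
Proof.
apply: leq_trans (@sum_conbr_few_pairs A (fun x y => k <= #|conbr x y :&: ~: A|) _ _).
- apply: leq_sum => x _; rewrite -sum1_card.
  rewrite (eq_bigl (fun y => (y \in A) && (k <= #|conbr x y :&: ~: A|))); last first.
    by move=> y; rewrite inE.
  apply: leq_sum => y /andP[_ fxy].
  by have := subset_leq_card (subsetIl (conbr x y) (~: A)); lia.
- by move=> x y; rewrite conbrC.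
- move=> w x p up sp pp; apply: (@no_fat_path (~: A) w x p) => // z /sp.
    by rewrite inE => /andP[].
  by rewrite !inE => /andP[_ ->].
Qed.

(* A fixed fat pair with k chosen common neighbours is separated from them by at
   least a fraction 2^-(k+2) of the sets A. *)
Lemma few_fat_pairs :
  \sum_x #|[set y | k <= #|conbr x y|]| <= 2 ^ (k + 2) * (2 * k) * degsum.
Proof.
pose G (A : {set 'I_n}) x y := [&& x \in A, y \in A & k <= #|conbr x y :&: ~: A|].
have many x y : k <= #|conbr x y| -> 2 ^ n <= (\sum_A G A x y) * 2 ^ (k + 2).
  case/card_geqP => s [us ss sc].
  pose W := [set z in s].
  have cW : #|W| = k by rewrite cardsE (card_uniqP us).
  have dW : [disjoint [set x; y] & W].
    rewrite -setI_eq0; apply/eqP/setP => z; rewrite !inE; apply/negP.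
    by case/andP => /orP[]/eqP -> /sc; rewrite !inE adj_irr ?andbF.
  have := leq_card_separating dW; rewrite card_ord => /leq_trans; apply.
  apply: leq_mul; last first.
    by rewrite leq_exp2l // cW addnC leq_add2l cards2; case: eqP.
  rewrite -sum1_card big_mkcond; apply: leq_sum => A _; rewrite inE /G.
  case: ifP => // /andP[]; rewrite subUset !sub1set => /andP[-> ->] dWA /=.
  suff -> : k <= #|conbr x y :&: ~: A| by [].
  rewrite -cW; apply: subset_leq_card; apply/subsetP => z zW.
  have zc : z \in conbr x y by apply: sc; move: zW; rewrite inE.
  by rewrite inE zc inE (disjointFr dWA zW).
(* Double counting of the triples [(x, y, A)] satisfying [G]: by pairs from below with [many], by
   sets from above with [few_pairs_fat_outside]. *)
rewrite -(leq_pmul2l (expn_gt0 2 n : 0 < 2 ^ n)).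
apply: (@leq_trans (\sum_x \sum_y (\sum_A G A x y) * 2 ^ (k + 2))).
  rewrite big_distrr; apply: leq_sum => x _ /=.
  rewrite -sum1_card big_distrr big_mkcond; apply: leq_sum => y _ /=.
  by rewrite inE; case: ifP => // /many; rewrite muln1.
have -> : \sum_x \sum_y (\sum_A G A x y) * 2 ^ (k + 2)
    = (\sum_(A : {set 'I_n}) \sum_(x in A) #|[set y in A | k <= #|conbr x y :&: ~: A|]|)
      * 2 ^ (k + 2).
  rewrite big_distrl /=.
  under eq_bigr => x _ do (under eq_bigr => y _ do rewrite big_distrl; rewrite exchange_big).
  rewrite exchange_big; apply: eq_bigr => A _ /=.
  rewrite big_distrl [RHS]big_mkcond; apply: eq_bigr => x _ /=.
  rewrite -big_distrl /G /=; case: ifP => xA; last by rewrite big1.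
  congr (_ * _); rewrite -sum1_card [RHS]big_mkcond; apply: eq_bigr => y _.
  by rewrite inE /=; case: ifP => /=.
have : \sum_(A : {set 'I_n}) \sum_(x in A) #|[set y in A | k <= #|conbr x y :&: ~: A|]|
    <= 2 ^ n * (2 * k * degsum).
  have -> : 2 ^ n = #|{set 'I_n}|.
    by rewrite -[RHS]cardsT -powersetT card_powerset cardsT card_ord.
  rewrite -sum_nat_const; apply: leq_sum => A _; exact: few_pairs_fat_outside.
move=> le; apply: leq_trans (leq_mul le (leqnn _)) _.
by rewrite -mulnA leq_mul2l [_ * degsum * _]mulnC mulnA leqnn orbT.
Qed.

(** The path bound is used twice: for the pairs [z], [t] inside the common neighbourhood of [x] and
    [y], which lies in [nbr x], and then for the pairs [x], [y], weighted by the codegree that the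
    first use leaves. *)
Lemma few_crossing_fat_pairs :
  \sum_x \sum_(y | 2 * k <= #|conbr x y|) \sum_(z in conbr x y)
     #|[set t in conbr x y | 2 * k <= #|conbr z t|]| <= (2 * k) ^ 2 * degsum.
Proof.
have RC : symmetric (fun x y => 2 * k <= #|conbr x y|).
  by move=> x y; rewrite conbrC.
have noP w x p : uniq (x :: p) -> {subset x :: p <= nbr w} ->
    path (fun x y => 2 * k <= #|conbr x y|) x p -> size p <> k.-1.
  move=> up sp pp zp.
  (* Removing the [k] path vertices from at least [2 * k] common neighbours leaves at least [k]
     connectors. *)
  apply: (@no_fat_path (~: [set z in x :: p]) w x p up sp _ _ zp).
    by move=> z zxp; rewrite inE in_set zxp.
  apply: sub_path pp => y z fyz; rewrite -setDE cardsD.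
  have le_k : #|conbr y z :&: [set z in x :: p]| <= k.
    apply: leq_trans (subset_leq_card (subsetIr _ _)) _.
    by rewrite cardsE (card_uniqP up) /= zp; lia.
  apply: leq_trans (leq_sub fyz le_k); lia.
apply: (@leq_trans (\sum_(x in [set: 'I_n]) \sum_(y in [set: 'I_n] | 2 * k <= #|conbr x y|)
     2 * k * #|conbr x y|)).
  rewrite [X in _ <= X](eq_bigl predT) => [|x]; last by rewrite inE.
  apply: leq_sum => x _.
  rewrite [X in _ <= X](eq_bigl (fun y => 2 * k <= #|conbr x y|)) => [|y]; last by rewrite inE.
  apply: leq_sum => y _.
  apply: leq_trans (path_few_pairs RC (m := k.-1) _) _.
    move=> z p up sp; apply: (noP x) => // t /sp.
    by rewrite inE => /andP[].
  by rewrite leq_mul2r; apply/orP; right; lia.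
under eq_bigr do rewrite -big_distrr.
rewrite -big_distrr /= -mulnn -[X in _ <= X]mulnA leq_pmul2l; last lia.
apply: sum_conbr_few_pairs RC _ => w x p up sp; apply: (noP w) => // z /sp.
by rewrite inE => /andP[].
Qed.

(** Otherwise there is a K_{k,k}: any [k] vertices of [T], in any order, form a path whose
    connectors can come from [B], and any vertex of [B] serves as [w]. *)
Lemma few_common_nbrs (T : {set 'I_n}) :
  k <= #|T| -> #|[set y | T \subset nbr y]| < k.
Proof.
case/card_geqP => -[|x p] [up zp sT]; first by move: zp => /=; lia.
set B := [set y | _]; rewrite ltnNge; apply/negP => kB.
have [w wB] : exists w, w \in B.
  by apply/card_gt0P; move: kB; lia.
have wT : T \subset nbr w by move: wB; rewrite inE.
have zp' : size p = k.-1 by rewrite -zp.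
apply: (@no_fat_path B w x p up _ _ _ zp').
- by move=> z /sT; apply: (subsetP wT).
- move=> z /sT zT; rewrite inE; apply/negP => /subsetP /(_ z zT).
  by rewrite inE adj_irr.
- apply/(pathP x) => i ip.
  have BT y : y \in T -> B \subset nbr y.
    move=> yT; apply/subsetP => z; rewrite !inE => /subsetP /(_ y yT).
    by rewrite inE adjC.
  rewrite (setIidPr _) // subsetI !BT //; apply: sT.
    by rewrite inE mem_nth ?orbT.
  by apply: mem_nth; apply: ltnW.
Qed.

(** Vertices are sorted by their trace on [S]. Traces smaller than [k] contribute at most [n * k] in
    all; each of the at most [2 ^ #|S|] larger traces occurs fewer than [k] times and contributes at
    most [#|S|] each time. *)
Lemma degree_sum_le (S : {set 'I_n}) :
  \sum_(x in S) #|nbr x| <= 2 ^ #|S| * k * #|S| + n * k.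
Proof.
have -> : \sum_(x in S) #|nbr x| = \sum_y #|nbr y :&: S|.
  under eq_bigr => x _ do rewrite -sum1_card big_mkcond.
  rewrite exchange_big /=; apply: eq_bigr => y _.
  rewrite -sum1_card -big_mkcondr; apply: eq_bigl => x.
  by rewrite !inE adjC andbC.
rewrite (bigID (fun y => k <= #|nbr y :&: S|)) /=; apply: leq_add; last first.
  rewrite big_mkcond -[X in X * k](card_ord n) -sum_nat_const; apply: leq_sum => y _.
  by case: ifP => //; rewrite -ltnNge => /ltnW.
apply: (@leq_trans (\sum_(y | k <= #|nbr y :&: S|) #|S|)).
  by apply: leq_sum => y _; rewrite subset_leq_card ?subsetIr.
rewrite sum_nat_const leq_mul2r; apply/orP; right.
rewrite -sum1_card (partition_big (fun y => nbr y :&: S) (mem (powerset S))) /=; last first.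
  by move=> y _; rewrite inE subsetIr.
rewrite -card_powerset -sum_nat_const; apply: leq_sum => T _.
have [kT|Tk] := leqP k #|T|; last first.
  rewrite big1 // => y /andP[ky /eqP eT].
  by move: Tk; rewrite -eT ltnNge => /negP; case; exact: ky.
apply: leq_trans (ltnW (few_common_nbrs kT)).
rewrite sum1_card; apply: subset_leq_card; apply/subsetP => y.
by rewrite unfold_in inE => /andP[_ /eqP <-]; apply: subsetIl.
Qed.

(** Call a degree high if it is at least n/(2q). With s = 4qk, a set of s high vertices would have
    degree sum at least 2kn, against about kn in [degree_sum_le]. So the high vertices contribute at
    most sn to the degree sum and the others at most n^2/(2q); for large n both are at most
    n^2/(2q). *)
Lemma few_edges (q : nat) (s := 4 * q * k) :
  0 < q -> 2 ^ s * s + 2 * q * s < n -> q * degsum <= n ^ 2.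
Proof.
move=> q0 nL.
pose H := [set x | n <= 2 * q * #|nbr x|].
have Hs : #|H| < s.
  rewrite ltnNge; apply/negP => /card_geqP [t [ut zt tH]].
  have := degree_sum_le [set x in t]; rewrite cardsE (card_uniqP ut) zt => le1.
  have : n * s <= 2 * q * \sum_(x in [set x in t]) #|nbr x|.
    rewrite big_distrr /= -zt -(card_uniqP ut) -cardsE mulnC -sum_nat_const.
    by apply: leq_sum => x; rewrite inE => /tH; rewrite inE.
  move=> le2; have := leq_trans le2 (leq_mul (leqnn (2 * q)) le1).
  move=> le3; have : 2 * q * k * n <= 2 * q * k * (2 ^ s * s).
    have : n * s = 2 * (2 * q * k * n) by rewrite /s; lia.
    lia.
  by rewrite leq_pmul2l; lia.
have split_sum : 2 * q * degsum <= 2 * q * (s * n) + n * n.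
  rewrite /degsum (bigID (mem H)) /= mulnDr leq_add //.
    rewrite leq_mul2l; apply/orP; right.
    apply: (@leq_trans (\sum_(x in H) n)).
      by apply: leq_sum => x _; rewrite -[X in _ <= X](card_ord n) max_card.
    by rewrite sum_nat_const leq_mul2r ltnW ?orbT.
  rewrite big_distrr /= -[X in X * n](card_ord n) -sum_nat_const big_mkcond.
  by apply: leq_sum => x _; case: ifP => //; rewrite inE -ltnNge => /ltnW.
have : 2 * q * s * n <= n * n by rewrite leq_mul2r; apply/orP; right; lia.
rewrite -mulnn; lia.
Qed.

End CycleFree.

(** * Counting four-cycles by their diagonals *)

Lemma card_pairs_le (r : rel 'I_n) (D : pred {set 'I_n}) :
  (forall x y, D [set x; y] -> r x y) ->
  #|[set P : {set 'I_n} | (#|P| == 2) && D P]| <= \sum_x #|[set y | r x y]|.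
Proof.
move=> Dr.
have -> : \sum_x #|[set y | r x y]| = #|[set p : 'I_n * 'I_n | r p.1 p.2]|.
  rewrite -[RHS]sum1_card [RHS](eq_bigl (fun p => r p.1 p.2)) => [|p]; last by rewrite inE.
  rewrite -(pair_big_dep predT r (fun _ _ => 1)) /=; apply: eq_bigr => x _.
  by rewrite -sum1_card; apply: eq_bigl => y; rewrite inE.
apply: leq_trans (leq_imset_card (fun p => [set p.1; p.2]) _).
apply: subset_leq_card; apply/subsetP => P; rewrite inE => /andP[/cards2P[x [y [_ ->]]] /Dr rxy].
by apply/imsetP; exists (x, y); rewrite ?inE.
Qed.

Definition common (P : {set 'I_n}) := [set y | P \subset nbr y].

Lemma common2 x y : common [set x; y] = conbr x y.
Proof. by apply/setP => z; rewrite !inE subUset !sub1set !inE adjC (adjC z). Qed.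

(** A C_4 is encoded by its two diagonals, the first being the one tested by [D]. *)
Definition squares (D : pred {set 'I_n}) :=
  [set PQ : {set 'I_n} * {set 'I_n} |
    (#|PQ.1| == 2) && D PQ.1 && ((PQ.2 \subset common PQ.1) && (#|PQ.2| == 2))].

Lemma card_squares_le (D : pred {set 'I_n}) m :
  (forall P, D P -> #|common P| <= m) ->
  #|squares D| <= #|[set P : {set 'I_n} | (#|P| == 2) && D P]| * 'C(m, 2).
Proof.
move=> Dm; rewrite -sum1_card (eq_bigl (fun PQ : {set 'I_n} * {set 'I_n} =>
    (#|PQ.1| == 2) && D PQ.1 && ((PQ.2 \subset common PQ.1) && (#|PQ.2| == 2)))) => [|PQ];
  last by rewrite inE.
rewrite -(pair_big_dep (fun P : {set 'I_n} => (#|P| == 2) && D P)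
  (fun P Q : {set 'I_n} => (Q \subset common P) && (#|Q| == 2)) (fun _ _ => 1)) /=.
rewrite -sum_nat_const [X in _ <= X](eq_bigl (fun P : {set 'I_n} => (#|P| == 2) && D P)); last first.
  by move=> P; rewrite inE.
apply: leq_sum => P /andP[_ /Dm cP].
rewrite sum1_card; apply: leq_trans (leq_bin2l 2 cP).
by rewrite -cards_draws subset_leq_card //; apply/subsetP => Q; rewrite unfold_in inE.
Qed.

End Graph.

(** The complete bipartite edge set between [P] and [Q]: a C_4 for disjoint pairs, and the extremal
    graph when [Q] is the complement of [P]. *)
Definition square n (P Q : {set 'I_n}) := [set [set pq.1; pq.2] | pq in setX P Q].

Lemma squareC n (P Q : {set 'I_n}) : square P Q = square Q P.
Proof.
apply/setP => e; apply/imsetP/imsetP => -[[x y]]; rewrite !inE => /andP[/= xP yQ] ->;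
  by exists (y, x); rewrite ?inE ?xP ?yQ // setUC.
Qed.

Lemma cycle4_square n (f : 'I_4 -> 'I_n) :
  cycle_edges f = square [set f (@Ordinal 4 0 isT); f (@Ordinal 4 2 isT)]
                         [set f (@Ordinal 4 1 isT); f (@Ordinal 4 3 isT)].
Proof.
set a := f (Ordinal _); set c := f (Ordinal _); set b := f (Ordinal _); set d := f (Ordinal _).
have Eab : [set a; b] \in cycle_edges f.
  by apply/imsetP; exists (@Ordinal 4 0 isT) => //; congr [set _; f _]; apply: val_inj.
have Ebc : [set b; c] \in cycle_edges f.
  by apply/imsetP; exists (@Ordinal 4 1 isT) => //; congr [set _; f _]; apply: val_inj.
have Ecd : [set c; d] \in cycle_edges f.
  by apply/imsetP; exists (@Ordinal 4 2 isT) => //; congr [set _; f _]; apply: val_inj.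
have Eda : [set d; a] \in cycle_edges f.
  by apply/imsetP; exists (@Ordinal 4 3 isT) => //; congr [set _; f _]; apply: val_inj.
apply/eqP; rewrite eqEsubset; apply/andP; split; apply/subsetP => e /imsetP.
- case=> i _ ->; apply/imsetP.
  case: i => [[|[|[|[|//]]]] i].
  + exists (a, b); first by rewrite !inE !eqxx.
    by congr [set f _; f _]; apply: val_inj.
  + exists (c, b); first by rewrite !inE !eqxx !orbT.
    by rewrite setUC; congr [set f _; f _]; apply: val_inj.
  + exists (c, d); first by rewrite !inE !eqxx !orbT.
    by congr [set f _; f _]; apply: val_inj.
  + exists (a, d); first by rewrite !inE !eqxx !orbT.
    by rewrite setUC; congr [set f _; f _]; apply: val_inj.
- case=> -[x y]; rewrite !inE /= => /andP[/orP[]/eqP -> /orP[]/eqP ->] -> //.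
  + by rewrite setUC.
  + by rewrite setUC.
Qed.

Lemma cycle4_copyP n (S : {set {set 'I_n}}) :
  is_cycle_copy 4 S ->
  exists P Q : {set 'I_n}, [/\ #|P| = 2, #|Q| = 2 & S = square P Q].
Proof.
case/existsP => f /andP[/injectiveP f_inj /eqP ->].
exists [set f (@Ordinal 4 0 isT); f (@Ordinal 4 2 isT)],
       [set f (@Ordinal 4 1 isT); f (@Ordinal 4 3 isT)].
by split; rewrite ?cards2 ?(inj_eq f_inj) //; apply: cycle4_square.
Qed.

Lemma square_cycle4_copy n (P Q : {set 'I_n}) :
  #|P| = 2 -> #|Q| = 2 -> [disjoint P & Q] -> is_cycle_copy 4 (square P Q).
Proof.
move=> /eqP/cards2P[a [c [ac ->]]] /eqP/cards2P[b [d [bd ->]]] dPQ.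
pose s := [:: a; b; c; d].
pose f : {ffun 'I_4 -> 'I_n} := [ffun i : 'I_4 => nth a s i].
have us : uniq s.
  have := disjointFr dPQ (set21 a c); rewrite !inE => /norP[ab ad].
  have := disjointFr dPQ (set22 a c); rewrite !inE => /norP[cb cd].
  by rewrite /= !inE !negb_or ab ac ad (eq_sym b c) cb bd cd.
apply/existsP; exists f; apply/andP; split.
  apply/injectiveP => i j; rewrite !ffunE => /eqP.
  by rewrite nth_uniq // => /eqP /val_inj.
by rewrite cycle4_square !ffunE.
Qed.

Lemma square_sub n (E : {set {set 'I_n}}) P Q :
  square P Q \subset E -> Q \subset common E P.
Proof.
move=> /subsetP sE; apply/subsetP => y yQ; rewrite inE; apply/subsetP => x xP.
rewrite inE adjC; apply: sE; apply/imsetP; exists (x, y) => //.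
by rewrite inE xP.
Qed.

(** Only the first term must be sharp, as it carries the leading coefficient; hence it counts
    unordered diagonals. The other two classes will be O(D), so there ordered pairs and repeated
    counting do no harm. *)
Lemma num_cycle4_le n (E : {set {set 'I_n}}) (k : nat) :
  0 < k ->
  num_cycles 4 E <= 'C(n, 2) * 'C(k.-1, 2)
    + (\sum_x #|[set y | k <= #|conbr E x y|]|) * 'C(2 * k, 2)
    + \sum_x \sum_(y | 2 * k <= #|conbr E x y|) \sum_(z in conbr E x y)
        #|[set t in conbr E x y | 2 * k <= #|conbr E z t|]|.
Proof.
move=> k0.
pose D1 (P : {set 'I_n}) := #|common E P| <= k.-1.
pose D2 (P : {set 'I_n}) := k <= #|common E P| <= 2 * k.
pose R x y := 2 * k <= #|conbr E x y|.
pose X3 := [set u : ('I_n * 'I_n) * ('I_n * 'I_n) | R u.1.1 u.1.2 &&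
  ((u.2.1 \in conbr E u.1.1 u.1.2) && ((u.2.2 \in conbr E u.1.1 u.1.2) && R u.2.1 u.2.2))].
pose sq (PQ : {set 'I_n} * {set 'I_n}) := square PQ.1 PQ.2.
pose sq3 (u : ('I_n * 'I_n) * ('I_n * 'I_n)) := square [set u.1.1; u.1.2] [set u.2.1; u.2.2].
have c1 : #|sq @: squares E D1| <= 'C(n, 2) * 'C(k.-1, 2).
  apply: leq_trans (leq_imset_card _ _) _.
  apply: leq_trans (card_squares_le (m := k.-1) _) _; first by [].
  rewrite leq_mul2r; apply/orP; right.
  rewrite -[X in 'C(X, 2)](card_ord n) -card_draws subset_leq_card //.
  by apply/subsetP => P; rewrite !inE => /andP[].
have c2 : #|sq @: squares E D2|
    <= (\sum_x #|[set y | k <= #|conbr E x y|]|) * 'C(2 * k, 2).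
  apply: leq_trans (leq_imset_card _ _) _.
  apply: leq_trans (card_squares_le (m := 2 * k) _) _; first by move=> P /andP[].
  rewrite leq_mul2r; apply/orP; right.
  apply: (@card_pairs_le _ (fun x y => k <= #|conbr E x y|)) => x y /andP[+ _].
  by rewrite common2.
have c3 : #|sq3 @: X3| <= \sum_x \sum_(y | 2 * k <= #|conbr E x y|) \sum_(z in conbr E x y)
        #|[set t in conbr E x y | 2 * k <= #|conbr E z t|]|.
  apply: leq_trans (leq_imset_card _ _) _.
  rewrite pair_big_dep -sum1_card [X in X <= _](eq_bigl (fun u : ('I_n * 'I_n) * ('I_n * 'I_n) =>
    R u.1.1 u.1.2 && ((u.2.1 \in conbr E u.1.1 u.1.2) &&
      ((u.2.2 \in conbr E u.1.1 u.1.2) && R u.2.1 u.2.2)))) => [|u]; last by rewrite inE.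
  rewrite -(pair_big_dep (fun p : 'I_n * 'I_n => R p.1 p.2) (fun p q : 'I_n * 'I_n =>
     (q.1 \in conbr E p.1 p.2) && ((q.2 \in conbr E p.1 p.2) && R q.1 q.2)) (fun _ _ => 1)) /=.
  apply: leq_sum => -[x y] _ /=.
  rewrite -(pair_big_dep (fun z => z \in conbr E x y)
    (fun z t => (t \in conbr E x y) && R z t) (fun _ _ => 1)) /=.
  apply: leq_sum => z _; rewrite -sum1_card.
  by rewrite [X in _ <= X](eq_bigl (fun t => (t \in conbr E x y) && R z t)) => [|t]; rewrite ?inE.
apply: leq_trans (leq_add (leq_add c1 c2) c3).
apply: (@leq_trans #|(sq @: squares E D1) :|: (sq @: squares E D2) :|: (sq3 @: X3)|); last first.
  apply: leq_trans (leq_card_setU _ _) _; rewrite leq_add2r.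
  exact: leq_card_setU.
apply: subset_leq_card; apply/subsetP => S; rewrite inE.
case/andP => SE /cycle4_copyP[P [Q [cP cQ eS]]].
have sPQ : Q \subset common E P by apply: square_sub; rewrite -eS.
have sQP : P \subset common E Q by apply: square_sub; rewrite squareC -eS.
have in_sq (D : pred {set 'I_n}) : D P -> S \in sq @: squares E D.
  by move=> DP; apply/imsetP; exists (P, Q) => //; rewrite inE /= cP cQ DP sPQ.
have in_sqC (D : pred {set 'I_n}) : D Q -> S \in sq @: squares E D.
  by move=> DQ; apply/imsetP; exists (Q, P); rewrite ?inE /= ?cP ?cQ ?DQ ?sQP // eS squareC.
rewrite !in_setU.
have [P1|P1] := leqP #|common E P| k.-1; first by rewrite in_sq.
have [Q1|Q1] := leqP #|common E Q| k.-1; first by rewrite in_sqC.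
have [P2|P2] := leqP #|common E P| (2 * k).
  by rewrite [in X in _ || X || _]in_sq ?orbT // /D2 P2 andbT; lia.
have [Q2|Q2] := leqP #|common E Q| (2 * k).
  by rewrite [in X in _ || X || _]in_sqC ?orbT // /D2 Q2 andbT; lia.
apply/orP; right; apply/imsetP.
move/eqP/cards2P: cP eS sPQ sQP P2 Q2 => [a [c [_ ->]]].
move/eqP/cards2P: cQ => [b [d [_ ->]]] eS.
rewrite !common2 subUset !sub1set => /andP[bP dP] _ P2 Q2.
by exists ((a, c), (b, d)) => //; rewrite inE /R /= bP dP (ltnW P2) (ltnW Q2).
Qed.

(** * The complete bipartite graph of the lower bound *)

Section CompleteBipartite.
Variables (n : nat) (X : {set 'I_n}).

Lemma mem_square_compl x y :
  [set x; y] \in square X (~: X) -> (x \in X) = (y \notin X).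
Proof.
case/imsetP => -[a b]; rewrite !inE /= => /andP[aX bX] e.
have : a \in [set x; y] by rewrite e set21.
have : b \in [set x; y] by rewrite e set22.
rewrite !inE => /orP[]/eqP eb /orP[]/eqP ea.
- by move: bX; rewrite eb -ea aX.
- have -> : x \in X = false by rewrite -eb (negbTE bX).
  by rewrite -ea aX.
- have -> : x \in X by rewrite -ea.
  by rewrite -eb bX.
- by move: bX; rewrite eb -ea aX.
Qed.

Lemma simple_square_compl : simple_graph (square X (~: X)).
Proof.
apply/forall_inP => _ /imsetP[[a b] + ->]; rewrite !inE /= cards2 => /andP[aX bX].
by case: (eqVneq a b) bX => // <-; rewrite aX.
Qed.

(** Membership in [X] alternates along a cycle, so the bijection [ordS] exchanges the indices inside
    and outside [U]; a C_{2m} would thus have exactly [m] vertices in [X]. *)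
Lemma square_compl_free m :
  0 < m -> #|X| < m -> ~~ contains_cycle (2 * m) (square X (~: X)).
Proof.
move=> m0 Xm; apply/existsP => -[S /andP[/subsetP SE /existsP[f]]].
case/andP => /injectiveP f_inj /eqP eS.
have alt i : (f i \in X) = (f (ordS i) \notin X).
  by apply: mem_square_compl; apply: SE; rewrite eS; apply/imsetP; exists i.
pose U := [set i | f i \in X].
have cU : #|U| <= #|X|.
  rewrite -(card_imset U f_inj); apply: subset_leq_card.
  by apply/subsetP => _ /imsetP[i + ->]; rewrite inE.
have : #|U| + #|~: U| = 2 * m by rewrite cardsC card_ord.
have -> : ~: U = [set i | ordS i \in U].
  by apply/setP => i; rewrite !inE alt negbK.
have -> : #|[set i | ordS i \in U]| = #|U|.
  rewrite -[RHS](card_preimset U (@ordS_inj _)).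
  by apply: eq_card => i; rewrite !inE.
lia.
Qed.

(** Each edge has one end in [X], which tells its [P]-end from its [Q]-end; nonemptiness puts every
    vertex on some edge. Applied in both directions, this shows that distinct pairs of diagonals
    give distinct four-cycles. *)
Lemma square_compl_subset (P Q P' Q' : {set 'I_n}) :
  P \subset X -> Q \subset ~: X -> P' \subset X -> Q' \subset ~: X ->
  Q != set0 -> P != set0 ->
  square P Q = square P' Q' -> (P \subset P') && (Q \subset Q').
Proof.
move=> /subsetP PX /subsetP QX /subsetP PX' /subsetP QX' /set0Pn[q0 q0Q] /set0Pn[p0 p0P] e.
have mem p q : p \in P -> q \in Q -> (p \in P') && (q \in Q').
  move=> pP qQ; have : [set p; q] \in square P' Q'.
    by rewrite -e; apply/imsetP; exists (p, q) => //; rewrite inE pP.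
  case/imsetP => -[a b]; rewrite !inE /= => /andP[aP bQ] e2.
  have := QX _ qQ; have := QX' _ bQ; rewrite !inE => bX qX.
  have : p \in [set a; b] by rewrite -e2 set21.
  have : q \in [set a; b] by rewrite -e2 set22.
  rewrite !inE => /orP[]/eqP eq /orP[]/eqP ep; subst.
  - by move: qX; rewrite PX'.
  - by move: qX; rewrite PX'.
  - by rewrite aP bQ.
  - by move: qX; rewrite PX.
apply/andP; split; apply/subsetP => z zP.
- by have /andP[] := mem _ _ zP q0Q.
- by have /andP[] := mem _ _ p0P zP.
Qed.

Lemma num_cycle4_square_compl :
  'C(#|X|, 2) * 'C(n - #|X|, 2) <= num_cycles 4 (square X (~: X)).
Proof.
have <- : #|~: X| = n - #|X| by rewrite cardsCs setCK card_ord.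
rewrite -!cards_draws -cardsX.
rewrite -(@card_in_imset _ _ (fun PQ : {set 'I_n} * {set 'I_n} => square PQ.1 PQ.2)).
  apply: subset_leq_card; apply/subsetP => _ /imsetP[[P Q] + ->].
  rewrite !inE /= => /andP[/andP[PX /eqP cP] /andP[QX /eqP cQ]]; apply/andP; split.
    apply/subsetP => _ /imsetP[[x y] + ->]; rewrite inE => /andP[/= xP yQ].
    by apply/imsetP; exists (x, y) => //; rewrite inE /= (subsetP PX) ?(subsetP QX).
  apply: square_cycle4_copy => //.
  by rewrite disjoints_subset (subset_trans PX) // -setCS setCK.
move=> [P Q] [P' Q']; rewrite !inE /= => /andP[/andP[PX /eqP cP] /andP[QX /eqP cQ]]
  /andP[/andP[PX' /eqP cP'] /andP[QX' /eqP cQ']] e.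
have n0 (A : {set 'I_n}) : #|A| = 2 -> A != set0 by move=> cA; rewrite -card_gt0 cA.
have /andP[s1 s2] : (P \subset P') && (Q \subset Q') by apply: square_compl_subset => //; apply: n0.
have /andP[s3 s4] : (P' \subset P) && (Q' \subset Q) by apply: square_compl_subset => //; apply: n0.
by congr (_, _); apply/eqP; rewrite eqEsubset ?s1 ?s2.
Qed.

End CompleteBipartite.

(** * Explicit bounds on the extremal number *)

Lemma ex_cycles_lower n k :
  0 < k <= n -> 'C(k.-1, 2) * 'C(n - k.-1, 2) <= ex_cycles n 4 (2 * k).
Proof.
case/andP => k0 kn.
have : k.-1 <= #|[set: 'I_n]| by rewrite cardsT card_ord; lia.
case/card_geqP => s [us zs _].
have cX : #|[set x in s]| = k.-1 by rewrite cardsE (card_uniqP us).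
have := num_cycle4_square_compl [set x in s]; rewrite cX => /leq_trans; apply.
rewrite /ex_cycles; apply: (leq_bigmax_cond (square [set x in s] (~: [set x in s]))).
by rewrite simple_square_compl square_compl_free // cX; lia.
Qed.

(** The free parameter [q] is an inverse precision: [few_edges] bounds D by n^2/q, so the
    lower-order classes cost a constant times n^2/q. *)
Lemma ex_cycles_upper k q :
  1 < k -> 0 < q -> exists N, forall n, N <= n ->
  q * ex_cycles n 4 (2 * k) <= q * ('C(n, 2) * 'C(k.-1, 2))
    + (2 ^ (k + 2) * (2 * k) * 'C(2 * k, 2) + (2 * k) ^ 2) * n ^ 2.
Proof.
move=> k1 q0; pose s := 4 * q * k.
exists (2 ^ s * s + 2 * q * s).+1 => n nN.
(* Dividing by [q] isolates the maximum, which can then be bounded graph by graph. *)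
rewrite mulnC -leq_divRL //; apply/bigmax_leqP => E /andP[gE fE].
rewrite leq_divRL // mulnC.
have := few_edges gE k1 fE q0 nN.
have := few_crossing_fat_pairs gE k1 fE.
have := few_fat_pairs gE k1 fE.
have := num_cycle4_le E (ltnW k1).
set D := degsum E; set F := \sum_x #|_|; set G := \sum_x \sum_(y | _) _.
set a := 'C(n, 2) * _; set b := 'C(2 * k, 2); set c := 2 ^ _ * _; set d := (2 * k) ^ 2.
move=> h1 h2 h3 h4.
have h5 : F * b <= c * D * b by rewrite leq_mul2r h2 orbT.
apply: leq_trans (_ : q * (a + (c * b + d) * D) <= _).
  by rewrite leq_mul2l; apply/orP; right; lia.
rewrite mulnDr leq_add2l mulnCA leq_mul2l h4 orbT //.
Qed.

(** This settles k = 2, where the main term vanishes and the relative error bound demands an exact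
    zero. *)
Lemma ex_cycles_same n m : ex_cycles n m m = 0.
Proof.
apply/eqP; rewrite -leqn0; apply/bigmax_leqP => E /andP[_ fE].
rewrite leqn0 cards_eq0; apply/eqP/setP => S; rewrite !inE; apply/negP => SE.
by case/negP: fE; apply/existsP; exists S.
Qed.

(** * The asymptotic estimate over the rationals *)

Import Order.TTheory GRing.Theory Num.Theory.
Local Open Scope ring_scope.

Lemma natr_bin2 m : ('C(m, 2))%:R = m%:R * (m%:R - 1) / 2 :> rat.
Proof.
elim: m => [|m IHm]; first by rewrite bin0n !mul0r.
by rewrite binS bin1 natrD IHm -natr1; field.
Qed.

(* ex(n, C_4, C_{2k}) = (1 + o(1)) (k-1)(k-2)/4 n^2, as n -> oo *)
Theorem theorem9 (k : nat) (hk : (2 <= k)%N) :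
  forall eps : rat, 0 < eps ->
  exists N : nat, forall n : nat, (N <= n)%N ->
    `| (ex_cycles n 4 (2 * k))%:R
       - ((k.-1)%:R * (k.-2)%:R / 4) * (n%:R ^+ 2) | 
    <= eps * (((k.-1)%:R * (k.-2)%:R / 4) * (n%:R ^+ 2)) :> rat.
Proof.
move=> eps eps0.
have [k2|k2] := eqVneq k 2%N.
  by exists 0%N => n _; rewrite k2 ex_cycles_same /= mulr0 !mul0r mulr0 subr0 normr0.
have k3 : (2 < k)%N by lia.
set c : rat := (k.-1)%:R * (k.-2)%:R / 4.
have c0 : 0 < c by rewrite !divr_gt0 ?mulr_gt0 ?ltr0n //; lia.
set K := (2 ^ (k + 2) * (2 * k) * 'C(2 * k, 2) + (2 * k) ^ 2)%N.
(* Chosen so that the error [K * n ^ 2 / q] is at most [eps * c * n ^ 2]. *)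
set q := (Num.truncn (K%:R / (eps * c))).+1.
have Kq : K%:R <= eps * c * q%:R.
  have ec0 : 0 < eps * c by rewrite mulr_gt0.
  by rewrite mulrC -ler_pdivrMr //; apply/ltW/truncnS_gt.
have [N1 up] := @ex_cycles_upper k q hk isT.
(* From [N2] on, 2k is at most eps n, whence (n-k+1)(n-k) >= n^2 - 2kn >= (1-eps) n^2 in the lower
   bound. *)
set N2 := (Num.truncn ((2 * k)%:R / eps)).+1.
exists (maxn k (maxn N1 N2)) => n; rewrite !geq_max => /and3P[kn nN1 nN2].
set e := ex_cycles n 4 (2 * k).
have kE : k%:R = (k.-1)%:R + 1 :> rat by rewrite natr1 prednK //; lia.
have kE' : (k.-1)%:R = (k.-2)%:R + 1 :> rat by rewrite natr1 prednK //; lia.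
(* The factor 2 cancels the one in C(n,2) = n(n-1)/2, so both bounds have leading coefficient
   [c]. *)
have cE : 'C(k.-1, 2)%:R = 2 * c by rewrite natr_bin2 /c kE'; field.
have eU : e%:R <= (1 + eps) * (c * n%:R ^+ 2).
  have := up n nN1; rewrite -/K -/e -(ler_nat rat) natrD (natrM _ K) natrX (natrM _ q e).
  rewrite (natrM _ q) (natrM _ 'C(n, 2)) natr_bin2 cE => h.
  have q0 : 0 < q%:R :> rat by rewrite ltr0n.
  rewrite -(ler_pM2l q0); apply: le_trans h _.
  have h1 : K%:R * n%:R ^+ 2 <= eps * c * q%:R * n%:R ^+ 2 by rewrite ler_wpM2r ?sqr_ge0.
  have h2 : 0 <= q%:R * (c * n%:R) by rewrite !mulr_ge0 // ltW.
  rewrite [leRHS](_ : _ = q%:R * (c * n%:R ^+ 2) + eps * c * q%:R * n%:R ^+ 2); last by ring.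
  have -> : q%:R * (n%:R * (n%:R - 1) / 2 * (2 * c))
      = q%:R * (c * n%:R ^+ 2) - q%:R * (c * n%:R).
    by field.
  lra.
have eL : (1 - eps) * (c * n%:R ^+ 2) <= e%:R.
  have := @ex_cycles_lower n k; rewrite kn andbT => /(_ (ltnW hk)).
  rewrite -(ler_nat rat) natrM cE natr_bin2 natrB; last lia.
  rewrite -/e; apply: le_trans.
  have nk : (2 * k)%:R <= eps * n%:R.
    rewrite mulrC -ler_pdivrMr //; apply: ltW; apply: lt_le_trans (truncnS_gt _) _.
    by rewrite ler_nat.
  have n0 : 0 <= n%:R :> rat by [].
  have h : (2 * k)%:R * n%:R <= eps * n%:R * n%:R by rewrite ler_wpM2r.
  rewrite (_ : 2 * c * _ = c * ((n%:R - (k.-1)%:R) * (n%:R - k%:R))); last by rewrite kE; field.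
  rewrite mulrCA ler_pM2l //.
  move: h; rewrite natrM => h.
  have k_ge1 : 1 <= k%:R :> rat by rewrite ler1n; lia.
  have -> : (k.-1)%:R = k%:R - 1 :> rat by rewrite kE addrK.
  nra.
rewrite ler_norml; apply/andP; split; lra.
Qed.
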